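(* The model-checking problem for A-HLTL is undecidable: there is no algorithm that, given a finite Kripke structure $\mathcal{K}$ and a closed A-HLTL formula $\varphi$, decides whether $\mathcal{K}\models\varphi$.
   Context: Let $\mathsf{AP}$ be a finite set of atomic propositions and $\Sigma=2^{\mathsf{AP}}$; traces are elements of $\Sigma^\omega$. A Kripke structure is $\mathcal{K}=\langle S,S_{\mathit{init}},\delta,L\rangle$ with initial states $S_{\mathit{init}}\subseteq S$, transition relation $\delta\subseteq S\times S$ where every state has a successor, and labeling $L:S\to\Sigma$; $\mathsf{Traces}(\mathcal{K})$ is the set of label sequences $L(s(0))L(s(1))\cdots$ of paths with $s(0)\in S_{\mathit{init}}$ and $(s(i),s(i+1))\in\delta$. A-HLTL syntax: $\varphi::=\exists\pi.\varphi\mid\forall\pi.\varphi\mid\mathsf{E}\psi\mid\mathsf{A}\psi$, $\psi::=a_\pi\mid\neg\psi\mid\psi\vee\psi\mid\psi\,\mathcal{U}\,\psi\mid\bigcirc\psi$ ($a\in\mathsf{AP}$, $\pi$ a trace variable), with usual abbreviations; a formula is closed if each atom $a_\pi$ has $\pi$ quantified and no variable is quantified twice. Semantics: trace assignments $\Pi$ map trace variables to pointed traces $(\sigma,p)$, $p\in\mathbb{N}$. A trajectory over $V$ is an infinite sequence $t=t(0)t(1)\cdots$ of nonempty subsets of $V$, fair if each $\pi\in V$ lies in infinitely many $t(j)$. $(\Pi,t)+1=(\Pi',t(1)t(2)\cdots)$, where $\Pi'(\pi)=(\sigma,p+1)$ if $\pi\in t(0)$ and $\Pi(\pi)=(\sigma,p)$,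 else $\Pi'(\pi)=\Pi(\pi)$; $(\Pi,t)+k$ iterates. Quantifiers $\exists\pi$/$\forall\pi$ bind $\pi$ to $(\sigma,0)$ for some/all $\sigma\in\mathsf{Traces}(\mathcal{K})$; $\Pi\models\mathsf{E}\psi$ (resp. $\mathsf{A}\psi$) iff $(\Pi,t)\models\psi$ for some (resp. all) fair trajectories $t$ over $\mathrm{Dom}(\Pi)$; $(\Pi,t)\models a_\pi$ iff $a\in\sigma(p)$ where $\Pi(\pi)=(\sigma,p)$; Booleans as usual; $(\Pi,t)\models\bigcirc\psi$ iff $(\Pi,t)+1\models\psi$; $(\Pi,t)\models\psi_1\mathcal{U}\psi_2$ iff for some $i\ge0$, $(\Pi,t)+i\models\psi_2$ and $(\Pi,t)+j\models\psi_1$ for all $j<i$. $\mathcal{K}\models\varphi$ iff the empty assignment satisfies $\varphi$. *)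

(* Defs.v *)
From mathcomp Require Import all_boot.

Set Implicit Arguments.
Unset Strict Implicit.
Unset Printing Implicit Defensive.

Definition trace (AP : finType) := nat -> {set AP}.

Record kripke (AP S : finType) := Kripke {
  k_init : {set S};
  k_trans : {set S * S};
  k_label : {ffun S -> {set AP}};
  k_total : [forall s, exists s', (s, s') \in k_trans]
}.

Definition traces (AP S : finType) (K : kripke AP S) (sigma : trace AP) : Prop :=
  exists s : nat -> S,
    [/\ s 0 \in k_init K,
        forall i, (s i, s i.+1) \in k_trans K
      & forall i, sigma i = k_label K (s i)].

Definition var := nat.

Inductive body (AP : Type) :=
| Atom (a : AP) (x : var)
| Neg (p : body AP)
| Or (p q : body AP)
| Until (p q : body AP)
| Next (p : body AP).

Inductive formula (AP : Type) :=
| Exists (x : var) (f : formula AP)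
| Forall (x : var) (f : formula AP)
| PathE (p : body AP)
| PathA (p : body AP).

Fixpoint body_vars (AP : Type) (p : body AP) : seq var :=
  match p with
  | Atom _ x => [:: x]
  | Neg p | Next p => body_vars p
  | Or p q | Until p q => body_vars p ++ body_vars q
  end.

(* [V] lists the variables quantified so far. *)
Fixpoint closed_in (AP : Type) (V : seq var) (f : formula AP) : bool :=
  match f with
  | Exists x f | Forall x f => (x \notin V) && closed_in (x :: V) f
  | PathE p | PathA p => all (mem V) (body_vars p)
  end.

Definition closed_formula (AP : Type) (f : formula AP) := closed_in [::] f.

Section Semantics.
Variable AP : finType.

(* Trace assignments are partial maps; [None] means "not in the domain". *)
Definition assignment := var -> option (trace AP * nat).

Definition dom (Pi : assignment) : pred var := fun x => isSome (Pi x).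

Definition empty_assignment : assignment := fun=> None.

Definition bind (Pi : assignment) (x : var) (sigma : trace AP) : assignment :=
  fun y => if y == x then Some (sigma, 0) else Pi y.

Definition trajectory := nat -> pred var.

Definition trajectory_over (V : pred var) (t : trajectory) : Prop :=
  forall j, (exists x, t j x) /\ (forall x, t j x -> V x).

Definition fair (V : pred var) (t : trajectory) : Prop :=
  forall x, V x -> forall n, exists2 j, n <= j & t j x.

Definition fair_trajectory_over (V : pred var) (t : trajectory) : Prop :=
  trajectory_over V t /\ fair V t.

Definition advance (c : assignment * trajectory) : assignment * trajectory :=
  let: (Pi, t) := c in
  (fun x => if t 0 x then omap (fun sp => (sp.1, sp.2.+1)) (Pi x) else Pi x,
   fun j => t j.+1).

Fixpoint sat_body (c : assignment * trajectory) (p : body AP) : Prop :=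
  match p with
  | Atom a x => if c.1 x is Some (sigma, n) then a \in sigma n else False
  | Neg p => ~ sat_body c p
  | Or p q => sat_body c p \/ sat_body c q
  | Until p q =>
      exists i, sat_body (iter i advance c) q /\
                (forall j, j < i -> sat_body (iter j advance c) p)
  | Next p => sat_body (advance c) p
  end.

Variables (S : finType) (K : kripke AP S).

Fixpoint sat (Pi : assignment) (f : formula AP) : Prop :=
  match f with
  | Exists x f => exists sigma, traces K sigma /\ sat (bind Pi x sigma) f
  | Forall x f => forall sigma, traces K sigma -> sat (bind Pi x sigma) f
  | PathE p => exists t, fair_trajectory_over (dom Pi) t /\ sat_body (Pi, t) p
  | PathA p => forall t, fair_trajectory_over (dom Pi) t -> sat_body (Pi, t) p
  end.

Definition models (f : formula AP) : Prop := sat empty_assignment f.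

End Semantics.

(* Minsky register machines: a program is a list of instructions, addressed by
   position, acting on
   registers that hold natural numbers:
   - [Inc r l] increments register [r] and jumps to [l];
   - [Dec r l l0] jumps to [l0] if register [r] is zero, and otherwise
     decrements [r] and jumps to [l].
   Execution halts when the program counter leaves the program.  The input is
   given in register 0, all other registers being zero, and the output is read
   from register 0.  As the number of registers is unbounded, these machines
   compute exactly the partial recursive functions. *)

Inductive instr :=
| Inc (r l : nat)
| Dec (r l l0 : nat).

Definition program := seq instr.

Definition config : Type := nat * (nat -> nat).

Definition update (m : nat -> nat) (r v : nat) : nat -> nat :=
  fun r' => if r' == r then v else m r'.

Definition step (P : program) (c : config) : config :=
  let: (pc, m) := c in
  match onth P pc with
  | Some (Inc r l) => (l, update m r (m r).+1)
  | Some (Dec r l l0) => if m r == 0 then (l0, m) else (l, update m r (m r).-1)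
  | None => (pc, m)
  end.

Definition start (x : nat) : config := (0, fun r => if r == 0 then x else 0).

Definition outputs (P : program) (x y : nat) : Prop :=
  exists k, let: (pc, m) := iter k (step P) (start x) in
            size P <= pc /\ m 0 = y.

Definition decides (P : program) (X : Type) (enc : X -> nat) (L : X -> Prop) :
    Prop :=
  forall x, (L x -> outputs P (enc x) 1) /\ (~ L x -> outputs P (enc x) 0).

(* As finite input data, atomic propositions and states are numbered. *)
Record instance := Instance {
  nb_props : nat;
  nb_states : nat;
  structure : kripke 'I_nb_props 'I_nb_states;
  spec : formula 'I_nb_props;
  spec_closed : closed_formula spec
}.

(* Formulas are written in Polish notation, and [structure] as the numbers of
   propositions and of states followed by the characteristic vectors of the
   initial states, of the transitions and of the labels.  The resulting word
   over [nat] is coded as one number by [CodeSeq.code]. *)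

Fixpoint body_word (AP : Type) (num : AP -> nat) (p : body AP) : seq nat :=
  match p with
  | Atom a x => [:: 0; num a; x]
  | Neg p => 1 :: body_word num p
  | Or p q => 2 :: body_word num p ++ body_word num q
  | Until p q => 3 :: body_word num p ++ body_word num q
  | Next p => 4 :: body_word num p
  end.

Fixpoint formula_word (AP : Type) (num : AP -> nat) (f : formula AP) : seq nat :=
  match f with
  | Exists x f => [:: 0, x & formula_word num f]
  | Forall x f => [:: 1, x & formula_word num f]
  | PathE p => 2 :: body_word num p
  | PathA p => 3 :: body_word num p
  end.

Definition kripke_word (m n : nat) (K : kripke 'I_m 'I_n) : seq nat :=
  [:: m, n &
    [seq (s \in k_init K : nat) | s <- enum 'I_n] ++
    [seq ((s, s') \in k_trans K : nat) | s <- enum 'I_n, s' <- enum 'I_n] ++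
    [seq (a \in k_label K s : nat) | s <- enum 'I_n, a <- enum 'I_m]].

Definition encode (i : instance) : nat :=
  CodeSeq.code (formula_word val (spec i) ++ kripke_word (structure i)).

Lemma body_word_tail (A B : Type) (f : A -> nat) (g : B -> nat)
    (p : body A) (q : body B) (u v : seq nat) :
  body_word f p ++ u = body_word g q ++ v -> u = v.
Proof.
elim: p q u v => [a x|p IHp|p1 IH1 p2 IH2|p1 IH1 p2 IH2|p IHp]
  [b y|q|q1 q2|q1 q2|q] u v //= [].
- by [].
- exact: IHp.
- by rewrite -!catA => /IH1/IH2.
- by rewrite -!catA => /IH1/IH2.
- exact: IHp.
Qed.

Lemma body_word_inj (A : Type) (f : A -> nat) (p q : body A) (u v : seq nat) :
  injective f -> body_word f p ++ u = body_word f q ++ v -> p = q.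
Proof.
move=> f_inj; elim: p q u v => [a x|p IHp|p1 IH1 p2 IH2|p1 IH1 p2 IH2|p IHp]
  [b y|q|q1 q2|q1 q2|q] u v //= [].
- by move=> /f_inj-> -> _.
- by move=> /IHp->.
- by rewrite -!catA => e; rewrite (IH1 _ _ _ e) (IH2 _ _ _ (body_word_tail e)).
- by rewrite -!catA => e; rewrite (IH1 _ _ _ e) (IH2 _ _ _ (body_word_tail e)).
- by move=> /IHp->.
Qed.

Lemma formula_word_tail (A B : Type) (f : A -> nat) (g : B -> nat)
    (p : formula A) (q : formula B) (u v : seq nat) :
  formula_word f p ++ u = formula_word g q ++ v -> u = v.
Proof.
elim: p q u v => [x p IHp|x p IHp|p|p] [y q|y q|q|q] u v //= [].
- by move=> _; apply: IHp.
- by move=> _; apply: IHp.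
- exact: body_word_tail.
- exact: body_word_tail.
Qed.

Lemma formula_word_inj (A : Type) (f : A -> nat) (p q : formula A)
    (u v : seq nat) :
  injective f -> formula_word f p ++ u = formula_word f q ++ v -> p = q.
Proof.
move=> f_inj; elim: p q u v => [x p IHp|x p IHp|p|p] [y q|y q|q|q] u v //= [].
- by move=> -> /IHp->.
- by move=> -> /IHp->.
- by move=> /(body_word_inj f_inj)->.
- by move=> /(body_word_inj f_inj)->.
Qed.

Lemma eq_bit_allpairs (S T : finType) (f g : S -> T -> bool) :
  [seq (f x y : nat) | x <- enum S, y <- enum T] =
  [seq (g x y : nat) | x <- enum S, y <- enum T] -> f =2 g.
Proof.
rewrite -(map_allpairs (fun z => (f z.1 z.2 : nat)) pair).
rewrite -(map_allpairs (fun z => (g z.1 z.2 : nat)) pair).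
move=> /eq_in_map e x y.
have /e/= : (x, y) \in [seq (x, y) | x <- enum S, y <- enum T].
  by apply/allpairsP; exists (x, y); rewrite !mem_enum.
by case: (f x y); case: (g x y).
Qed.

Lemma kripke_word_inj (m n : nat) : injective (@kripke_word m n).
Proof.
move=> [i1 t1 l1 h1] [i2 t2 l2 h2] [] /eqP.
rewrite eqseq_cat ?size_map // => /andP[/eqP/eq_in_map ei].
rewrite eqseq_cat ?size_allpairs // => /andP[/eqP et /eqP el].
have Ei : i1 = i2.
  apply/setP=> s; have := ei s; rewrite mem_enum => /(_ isT).
  by case: (s \in i1); case: (s \in i2).
have Et : t1 = t2.
  by apply/setP=> -[s s']; exact: (eq_bit_allpairs et).
have El : l1 = l2.
  by apply/ffunP=> s; apply/setP=> a; exact: (eq_bit_allpairs el).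
by case: _ / Ei; case: _ / El; case: _ / Et h2 {et} => h2; rewrite (bool_irrelevance h1 h2).
Qed.

Lemma encode_inj : injective encode.
Proof.
move=> [m n K f hf] [m' n' K' f' hf'].
move=> /(can_inj CodeSeq.codeK)/= e.
have e' := formula_word_tail e; case: (e') => em en _.
case: _ / em f' hf' K' e e' => f' hf' K'; case: _ / en K' => K' e e'.
have ef := formula_word_inj val_inj e; case: _ / ef hf' {e} => hf'.
by rewrite (kripke_word_inj e') (bool_irrelevance hf hf').
Qed.

(* Main.v *)
(* Suppose that P decides model checking.  A universal quantifier over
   trajectories lets a formula with two existentially quantified traces compare a
   trace with itself, both in lockstep and at a fixed delay L: this expresses
   that the trace is a space-time diagram, with rows of width L, of a halting
   computation of a counter machine, with input x prescribed by a block of x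
   [Next]s.  Hence "machine M halts on x" becomes an instance of model checking
   whose code word is w 4^x v, where w is fixed and v depends on M only.
   Let M, on input x, add to the word coded by x the x letters 4 and w in front,
   run P on the resulting code, and halt if and only if P answers 0.
   For x the code of v, M runs P on the instance "M halts on x" itself. *)

Require Import Defs.
From mathcomp Require Import all_boot.
From Stdlib Require Import Setoid Classical.

Set Implicit Arguments.
Unset Strict Implicit.
Unset Printing Implicit Defensive.

(** * Formulas that describe helical tilings *)

Section Connectives.
Variable AP : finType.
Implicit Types (c : assignment AP * trajectory) (p q : body AP).

Definition And p q := Neg (Or (Neg p) (Neg q)).
(* [tt] has to be a valid formula: the syntax has no constant for truth. *)
Definition Always (tt p : body AP) := Neg (Until tt (Neg p)).

Lemma sat_and c p q : sat_body c (And p q) <-> sat_body c p /\ sat_body c q.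
Proof.
split=> /= [pq|[cp cq] [//|//]].
by split; apply: NNPP => nr; apply: pq; [left | right].
Qed.

Lemma sat_or_neg c p q :
  sat_body c (Or p (Neg q)) <-> (sat_body c q -> sat_body c p).
Proof.
split=> /= [[//|//]|qp]; have [/qp|] := classic (sat_body c q); by [left|right].
Qed.

Lemma sat_until c i p q :
  sat_body (iter i (@advance AP) c) (Until p q) <->
  exists j, sat_body (iter (i + j) (@advance AP) c) q /\
    forall k, k < j -> sat_body (iter (i + k) (@advance AP) c) p.
Proof.
split=> -[j [qj pk]]; exists j.
  by split=> [|k /pk]; rewrite addnC iterD.
by split=> [|k /pk]; rewrite -iterD addnC.
Qed.

Lemma sat_always c i tt p :
    (forall k, sat_body (iter k (@advance AP) c) tt) ->
  sat_body (iter i (@advance AP) c) (Always tt p) <->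
  (forall j, sat_body (iter (i + j) (@advance AP) c) p).
Proof.
move=> satT; rewrite -[sat_body _ (Always _ _)]/(~ sat_body _ (Until tt (Neg p))).
rewrite sat_until; split=> [np j|pj [j [/= npj _]]]; last exact: npj.
by apply: NNPP => npj; apply: np; exists j; split.
Qed.

Lemma sat_iter_next c i x p :
  sat_body (iter i (@advance AP) c) (iter x (@Next AP) p) <->
  sat_body (iter (i + x) (@advance AP) c) p.
Proof.
elim: x i => [|x IHx] i; first by rewrite addn0.
by rewrite addnS -addSn -IHx.
Qed.

Lemma iter_advance2 c i j : (iter i (@advance AP) c).2 j = c.2 (i + j).
Proof.
elim: i j => //= i IHi j; rewrite addSnnS -IHi.
by case: (iter i _ c).
Qed.

Lemma iter_advance1 c i x : (iter i (@advance AP) c).1 x =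
  omap (fun sp => (sp.1, sp.2 + \sum_(j < i) c.2 j x)) (c.1 x).
Proof.
elim: i => [|i IHi] /=.
  by case: (c.1 x) => //= -[s p]; rewrite big_ord0 addn0.
rewrite big_ord_recr /=.
have := iter_advance2 c i 0; rewrite addn0.
case: (iter i _ c) IHi => Pi t /= -> ->.
by case: (c.1 x) => [[s p]|]; case: (c.2 i x); rewrite //= ?addn1 ?addn0 ?addnS.
Qed.

End Connectives.

Lemma body_word_iter_next (A : Type) (num : A -> nat) x (p : body A) :
  body_word num (iter x (@Next A) p) = nseq x 4 ++ body_word num p.
Proof. by elim: x => //= x ->. Qed.

Section TilingFormula.
Variables (T : finType) (ini inp fin first : pred T) (h v : rel T).

(* A tiling of a half-strip of width [L] whose rows are concatenated: the upper
   neighbour of position [p] is [p + L]. *)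
Definition tileable (x : nat) := exists sigma : nat -> T, exists L,
  [/\ ini (sigma 0), inp (sigma x), exists k, fin (sigma k),
      (forall p, p < L -> first (sigma p)) /\ ~~ first (sigma L) &
      forall p, h (sigma p) (sigma p.+1) /\ v (sigma p) (sigma (p + L))].

(* The Boolean is a clock, which flips at every position: it makes visible which
   traces a trajectory moves. *)
Definition letter : finType := (T * bool)%type.
(* One proposition per set of letters: every predicate on the current letter is
   an atom. *)
Definition prop : finType := 'I_#|{set letter}|.
Definition state : finType := 'I_#|letter|.

Definition clocked : {set state * state} :=
  [set s | (enum_val s.1).2 != (enum_val s.2).2].
Definition labels : {ffun state -> {set prop}} :=
  [ffun s => [set a : prop | enum_val s \in enum_val a]].

Lemma clocked_total : [forall s, exists s', (s, s') \in clocked].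
Proof.
apply/forallP=> s; apply/existsP; case e: (enum_val s) => [a b].
exists (enum_rank ((a, ~~ b) : letter)).
by rewrite inE /= enum_rankK e /=; case: (b).
Qed.

Definition tiling_kripke : kripke prop state := Kripke setT labels clocked_total.

Definition lit (P : pred letter) (x : var) : body prop :=
  Atom (enum_rank [set a | P a] : prop) x.

Definition truth := lit predT 0.

(** Atoms are unary, so a binary relation is tested by cases on the letter [a] under [x]; [F] reads
    the second letter. *)
Definition related (r : rel letter) (x : var) (F : pred letter -> body prop) :=
  foldr (fun a p => And (Or (F (r a)) (Neg (lit (pred1 a) x))) p) truth
    (enum letter).

Definition moves x :=
  related (fun a b => a.2 != b.2) x (fun P => Next (lit P x)).
Definition synchronous := Always truth (And (moves 0) (moves 1)).
Definition agree :=
  related (fun a b => a.1 == b.1) 0 (fun P => lit P 1).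
Definition horizontal :=
  related (fun a b => h a.1 b.1) 0 (fun P => Next (lit P 0)).
Definition vertical :=
  related (fun a b => v a.1 b.1) 0 (fun P => lit P 1).
Definition tile_lit (P : pred T) := lit (fun a => P a.1).

(* Trace 1 alone moves through the first row, hence gets [L] positions ahead, then
   both traces move in lockstep and violate a vertical constraint. *)
Definition shift_test :=
  Until (And (tile_lit first 1) (And (Neg (moves 0)) (moves 1)))
        (And (Neg (tile_lit first 1))
          (And synchronous (Neg (Always truth vertical)))).

(** As the body must hold on all fair trajectories, each constraint is guarded: by lockstep, or for
    the vertical one by the premises inside [shift_test]. *)
Definition tiling_rest :=
  And (Or (And (tile_lit ini 0) (And (Until truth (tile_lit fin 0))
            (Always truth (And agree horizontal)))) (Neg synchronous))
      (Neg shift_test).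

(** The [Next] block is put first, so that in the code word only quantifiers and connectives precede
    it. *)
Definition tiling_body x :=
  And (Or (iter x (@Next prop) (tile_lit inp 0)) (Neg synchronous)) tiling_rest.

Definition tiling_formula x : formula prop :=
  Exists 0 (Exists 1 (PathA (tiling_body x))).

Lemma related_vars r x F : (forall P, all (mem [:: 1; 0]) (body_vars (F P))) ->
  x < 2 -> all (mem [:: 1; 0]) (body_vars (related r x F)).
Proof.
move=> FV x2; have xV : x \in [:: 1; 0] by case: x x2 => [|[]].
by rewrite /related; elim: (enum _) => //= a s IH; rewrite !all_cat IH FV /= xV.
Qed.

Lemma tiling_formula_closed x : closed_formula (tiling_formula x).
Proof.
have iterV p : body_vars (iter x (@Next prop) p) = body_vars p.
  by elim: x => //= n ->.
rewrite /closed_formula /= !all_cat iterV /=.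
rewrite /agree /horizontal /vertical /moves.
by do !rewrite ?all_cat /=; rewrite !related_vars.
Qed.

(** * Evaluation of the formulas along one trajectory *)

Section Run.
Variables (c : assignment prop * trajectory) (s : var -> nat -> letter).
Hypothesis clock : forall x, x < 2 -> forall i, (s x i).2 != (s x i.+1).2.
Hypothesis read : forall x, x < 2 -> exists tau,
  c.1 x = Some (tau, 0) /\ forall i, tau i = labels (enum_rank (s x i)).

Notation at_ i := (iter i (@advance prop) c).
Let pos x i := \sum_(j < i) c.2 j x.

Lemma posS x i : pos x i.+1 = pos x i + c.2 i x.
Proof. exact: big_ord_recr. Qed.

Lemma sat_lit i P x : x < 2 -> sat_body (at_ i) (lit P x) <-> P (s x (pos x i)).
Proof.
move=> x2 /=; rewrite iter_advance1; have [tau [-> tauE]] := read x2.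
by rewrite /= add0n tauE ffunE inE !enum_rankK inE.
Qed.

Lemma sat_truth i : sat_body (at_ i) truth.
Proof. exact/sat_lit. Qed.

Lemma sat_related i r x F b : x < 2 ->
    (forall P : pred letter, sat_body (at_ i) (F P) <-> P b) ->
  sat_body (at_ i) (related r x F) <-> r (s x (pos x i)) b.
Proof.
move=> x2 Fb; rewrite /related.
have : s x (pos x i) \in enum letter by rewrite mem_enum.
set a := s x _; elim: (enum _) => // a' e IH; rewrite in_cons.
rewrite [foldr _ _ _]/(And _ _) sat_and sat_or_neg sat_lit // Fb -/a.
(* Letters other than [a] contribute only vacuous implications. *)
have aux : a \notin e ->
    sat_body (at_ i)
      (foldr (fun a p => And (Or (F (r a)) (Neg (lit (pred1 a) x))) p) truth e).
  elim: e {IH} => [|a1 e IH]; first by move=> _; apply: sat_truth.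
  rewrite in_cons negb_or => /andP[aa1 ae].
  rewrite [foldr _ _ _]/(And _ _) sat_and sat_or_neg sat_lit // -/a; split; last exact: IH.
  by move/eqP=> aa1'; rewrite aa1' eqxx in aa1.
case: (boolP (a \in e)) => [ae _|ae].
  by rewrite IH //; split=> [[]//|rab]; split=> // /eqP<-.
rewrite orbF => /eqP aa'; split=> [[/= + _]|rab].
  by rewrite aa'; apply.
by split; [rewrite -aa' | exact: aux].
Qed.

(** A moving trace flips its bit by [clock]; a resting one is read twice at the same position. *)
Lemma sat_moves i x : x < 2 -> sat_body (at_ i) (moves x) <-> c.2 i x.
Proof.
move=> x2; rewrite /moves (@sat_related _ _ _ _ (s x (pos x i.+1))) //.
  rewrite posS; case: (c.2 i x); rewrite ?addn1 ?addn0 ?eqxx //.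
  by split=> // _; apply: clock.
by move=> P; rewrite -(sat_lit i.+1 P x2).
Qed.

Lemma sat_synchronous i : sat_body (at_ i) synchronous <->
  forall j, c.2 (i + j) 0 /\ c.2 (i + j) 1.
Proof.
rewrite /synchronous (sat_always _ _ sat_truth).
by split=> H j; have := H j; rewrite sat_and !sat_moves.
Qed.

Lemma sat_tile_lit i P x : x < 2 ->
  sat_body (at_ i) (tile_lit P x) <-> P (s x (pos x i)).1.
Proof. by move=> x2; rewrite sat_lit. Qed.

Lemma sat_agree i : sat_body (at_ i) agree <->
  (s 0 (pos 0 i)).1 == (s 1 (pos 1 i)).1.
Proof.
by rewrite /agree (@sat_related _ _ _ _ (s 1 (pos 1 i))) // => P; rewrite sat_lit.
Qed.

Lemma sat_vertical i : sat_body (at_ i) vertical <->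
  v (s 0 (pos 0 i)).1 (s 1 (pos 1 i)).1.
Proof.
by rewrite /vertical (@sat_related _ _ _ _ (s 1 (pos 1 i))) // => P; rewrite sat_lit.
Qed.

Lemma sat_horizontal i : sat_body (at_ i) horizontal <->
  h (s 0 (pos 0 i)).1 (s 0 (pos 0 i.+1)).1.
Proof.
rewrite /horizontal (@sat_related _ _ _ _ (s 0 (pos 0 i.+1))) // => P.
by rewrite -(sat_lit i.+1 P).
Qed.

Lemma pos_sync i x j : (forall k, c.2 (i + k) x) -> pos x (i + j) = pos x i + j.
Proof.
move=> sync; elim: j => [|j IHj]; first by rewrite !addn0.
by rewrite addnS posS IHj sync addn1 addnS.
Qed.

(** Until step [L] only trace 1 moves, so the positions are then 0 and [L]; lockstep preserves this
    distance. *)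
Lemma sat_shift_test : sat_body c shift_test <->
  exists L, [/\ forall j, j < L -> first (s 1 j).1 /\ (~~ c.2 j 0 /\ c.2 j 1),
    ~~ first (s 1 L).1, forall j, c.2 (L + j) 0 /\ c.2 (L + j) 1
    & exists j, ~~ v (s 0 j).1 (s 1 (L + j)).1].
Proof.
have posL L : (forall j, j < L -> ~~ c.2 j 0 /\ c.2 j 1) ->
    pos 0 L = 0 /\ pos 1 L = L.
  elim: L => [|L IHL] cL; first by rewrite /pos !big_ord0.
  have [j jL|p0 p1] := IHL; first exact/cL/ltnW.
  by rewrite !posS p0 p1; have [/negbTE-> ->] := cL _ (leqnn _); rewrite addn1.
rewrite -[c in sat_body c _]/(at_ 0) sat_until.
split=> -[L]; rewrite ?add0n.
  rewrite !sat_and sat_synchronous => -[[nf [sync nv]] guard].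
  have guardL j : j < L -> ~~ c.2 j 0 /\ c.2 j 1.
    move=> /guard; rewrite add0n !sat_and sat_moves // => -[_ [n0 c1]].
    by split=> //; apply/negP=> c0; apply: n0; apply/sat_moves.
  have [p0 p1] := posL L guardL.
  exists L; split=> //.
  - move=> j jL; split; last exact: guardL.
    have := guard j jL; rewrite add0n !sat_and sat_tile_lit // => -[+ _].
    have [|_ ->//] := posL j.
    by move=> k kj; apply: guardL; apply: ltn_trans jL.
  - by apply/negP=> f; apply: nf; apply/sat_tile_lit; rewrite ?p1.
  apply: NNPP => nex; apply: nv; apply/(sat_always _ _ sat_truth) => j.
  apply/sat_vertical; rewrite !pos_sync => [|k|k]; try by case: (sync k).
  by rewrite p0 p1 add0n; apply/negPn/negP => nvj; apply: nex; exists j.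
move=> [guard nf sync [j nv]].
have [|p0 p1] := posL L; first by move=> j' /guard[].
exists L; rewrite !add0n; split.
  rewrite !sat_and sat_synchronous; split; last split=> //.
    by move=> /(@sat_tile_lit _ _ 1 isT); rewrite p1; apply/negP.
  move=> /(sat_always _ _ sat_truth)/(_ j)/sat_vertical.
  rewrite !pos_sync => [|k|k]; try by case: (sync k).
  by rewrite p0 p1 add0n; apply/negP.
move=> k kL; rewrite add0n !sat_and sat_moves // sat_tile_lit //.
have [|_ ->] := posL k; first by move=> j' j'k; case: (guard j' (ltn_trans j'k kL)).
have [f [n0 c1]] := guard k kL; split=> //; split=> // /sat_moves c0.
by rewrite c0 in n0.
Qed.

Lemma sat_tiling_body x : sat_body c (tiling_body x) <->
  [/\ ((forall j, c.2 j 0 /\ c.2 j 1) ->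
        [/\ inp (s 0 x).1, ini (s 0 0).1, exists k, fin (s 0 k).1
        & forall j, (s 0 j).1 = (s 1 j).1 /\ h (s 0 j).1 (s 0 j.+1).1])
    & ~ exists L, [/\ forall j, j < L -> first (s 1 j).1 /\ (~~ c.2 j 0 /\ c.2 j 1),
          ~~ first (s 1 L).1, forall j, c.2 (L + j) 0 /\ c.2 (L + j) 1
        & exists j, ~~ v (s 0 j).1 (s 1 (L + j)).1]].
Proof.
rewrite !sat_and !sat_or_neg -sat_shift_test.
have -> : sat_body c synchronous <-> forall j, c.2 j 0 /\ c.2 j 1.
  exact: (sat_synchronous 0).
have posE : (forall j, c.2 j 0 /\ c.2 j 1) -> forall x j, x < 2 -> pos x j = j.
  move=> sync y j y2; rewrite -[j in pos y j]add0n pos_sync.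
    by rewrite /pos big_ord0.
  by move=> k; case: (sync k); case: y y2 => [|[]].
rewrite !sat_and.
have -> : sat_body c (iter x (@Next prop) (tile_lit inp 0)) <-> inp (s 0 (pos 0 x)).1.
  by rewrite (sat_iter_next c 0) sat_tile_lit.
have -> : sat_body c (tile_lit ini 0) <-> ini (s 0 (pos 0 0)).1.
  exact: (@sat_tile_lit 0).
have -> : sat_body c (Until truth (tile_lit fin 0)) <-> exists k, fin (s 0 (pos 0 k)).1.
  rewrite (sat_until c 0); split=> -[k].
    by rewrite sat_tile_lit // => -[fk _]; exists k.
  by move=> fk; exists k; rewrite sat_tile_lit //; split=> // j _; apply: sat_truth.
have -> : sat_body c (Always truth (And agree horizontal)) <->
   forall j, (s 0 (pos 0 j)).1 = (s 1 (pos 1 j)).1 /\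
             h (s 0 (pos 0 j)).1 (s 0 (pos 0 j.+1)).1.
  rewrite (sat_always 0 _ sat_truth); split=> H j; have := H j.
    by rewrite sat_and sat_agree sat_horizontal => -[/eqP].
  by rewrite sat_and sat_agree sat_horizontal => -[-> ->].
split=> [[Hx [Hr Hs]]|[H Hs]]; split=> //.
- move=> sync; have P := posE sync.
  have [] := Hr sync; rewrite P // => H0 [[k]]; rewrite P // => fk Hj.
  have := Hx sync; rewrite P // => H1; split=> //; first by exists k.
  by move=> j; have := Hj j; rewrite !P.
- by move=> sync; rewrite posE //; case: (H sync).
split=> // sync; have P := posE sync; have [_ H0 [k fk] Hj] := H sync.
rewrite P //; split=> //; split; first by exists k; rewrite P.
by move=> j; have := Hj j; rewrite !P.
Qed.

End Run.

(** * Model checking expresses tileability *)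

Hypothesis fin_not_first : forall a, fin a -> ~~ first a.

(** From left to right two trajectories suffice: lockstep gives all but the vertical constraints,
    and a delay of trace 0 by [L] steps gives these. Conversely, both variables are bound to the
    same trace, the tiling with the parity of positions as clock. *)
Lemma models_tiling x : models tiling_kripke (tiling_formula x) <-> tileable x.
Proof.
split.
  move=> [tau0 [[u0 [_ tr0 lab0]] [tau1 [[u1 [_ tr1 lab1]] allT]]]].
  pose s y i : letter := if y == 0 then enum_val (u0 i) else enum_val (u1 i).
  pose Pi := bind (bind (empty_assignment prop) 0 tau0) 1 tau1.
  have clock y : y < 2 -> forall i, (s y i).2 != (s y i.+1).2.
    move=> _ i; rewrite /s; case: ifP => _.
      by have := tr0 i; rewrite /= !inE.
    by have := tr1 i; rewrite /= !inE.
  have read t y : y < 2 -> exists tau, (Pi, t : trajectory).1 y = Some (tau, 0) /\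
      forall i, tau i = labels (enum_rank (s y i)).
    case: y => [|[|//]] _; [exists tau0 | exists tau1]; split=> // i.
      by rewrite /s /= enum_valK lab0.
    by rewrite /s /= enum_valK lab1.
  have dom2 y : (y < 2) = dom Pi y by case: y => [|[]].
  pose sync : trajectory := fun _ y => y < 2.
  have sync_fair : fair_trajectory_over (dom Pi) sync.
    split=> [j|y Vy n]; last by exists n; rewrite // /sync dom2.
    by split=> [|y]; [exists 0 | rewrite /sync dom2].
  have [+ _] := (sat_tiling_body clock (read sync) x).1 (allT _ sync_fair).
  case=> // Hinp Hini [k Hk] Hs.
  (* A final tile is outside the first row, so the first row ends; [L] is its width. *)
  have exL : exists i, ~~ first (s 0 i).1 by exists k; apply: fin_not_first.
  have [L nfL minL] := ex_minnP exL.
  have fL p : p < L -> first (s 0 p).1.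
    by move=> pL; apply/negPn/negP => /minL; rewrite leqNgt pL.
  pose delay : trajectory := fun j y => if j < L then y == 1 else y < 2.
  have delay_fair : fair_trajectory_over (dom Pi) delay.
    split=> [j|y Vy n].
      split=> [|y]; first by exists 1; rewrite /delay; case: ifP.
      by rewrite /delay -dom2; case: ifP => // _ /eqP->.
    exists (n + L); first exact: leq_addr.
    by rewrite /delay ltnNge leq_addl /= dom2.
  have [_ Hdelay] := (sat_tiling_body clock (read delay) x).1 (allT _ delay_fair).
  exists (fun i => (s 0 i).1), L; split=> //; first by exists k.
  move=> p; split; first by have [] := Hs p.
  apply/negPn/negP => nv; apply: Hdelay; exists L; split.
  - by move=> j jL; rewrite /delay /= jL -(Hs j).1; split=> //; apply: fL.
  - by rewrite -(Hs L).1.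
  - by move=> j; rewrite /delay /= ltnNge leq_addr.
  by exists p; rewrite -(Hs (L + p)).1 addnC.
move=> [sigma [L [Hini Hinp Hfin [Hf nf] Hhv]]].
pose s (y : var) i : letter := (sigma i, odd i).
pose tau : trace prop := fun i => labels (enum_rank (s 0 i)).
have trace_tau : traces tiling_kripke tau.
  exists (fun i => enum_rank (s 0 i)); split=> //.
  by move=> i; rewrite /= inE !enum_rankK /=; case: (odd i).
exists tau; split=> //; exists tau; split=> // t [over_t fair_t].
apply/(@sat_tiling_body _ s).
- by move=> y _ i /=; case: (odd i).
- by case=> [|[|//]] _; exists tau.
split=> [_|].
  split=> // j; split=> //.
  by case: (Hhv j).
move=> [L' [HL' nf' _ [j]]] /=.
(* Both are the least position outside the first row. *)
suff -> : L' = L by rewrite addnC; case: (Hhv j) => _ ->.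
apply/eqP; rewrite eqn_leq; apply/andP; split; rewrite leqNgt; apply/negP.
  by move=> /HL'[/= f _]; rewrite f in nf.
by move=> /Hf f; rewrite /= f in nf'.
Qed.

(** The nine letters are the two quantifiers with their variables, [PathA], the [Neg], [Or], [Neg]
    of the outer [And], and the [Or] whose left part is the [Next] block. *)
Lemma tiling_formula_word : exists w, forall x,
  formula_word val (tiling_formula x) =
    [:: 0; 0; 0; 1; 3; 1; 2; 1; 2] ++ nseq x 4 ++ w.
Proof.
exists (body_word val (tile_lit inp 0) ++ 1 :: body_word val synchronous ++
        1 :: body_word val tiling_rest) => x.
rewrite /tiling_formula /tiling_body; move: (tile_lit _ _) synchronous tiling_rest.
by move=> p q r /=; rewrite body_word_iter_next -!catA.
Qed.

End TilingFormula.

(** * Counter machines as tilings *)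

Section Machine.
Variables (C R : finType).

Inductive action := Keep | Up | Down.

Definition apply_action a n :=
  match a with Keep => n | Up => n.+1 | Down => n.-1 end.

Variables (next : C -> {set R} -> C) (act : C -> {set R} -> R -> action).
Variables (c0 halt : C) (I : {set R}).

Definition memory := {ffun R -> nat}.

Definition support (m : memory) := [set r | m r != 0].

Definition mstep (s : C * memory) : C * memory :=
  (next s.1 (support s.2),
   [ffun r => apply_action (act s.1 (support s.2) r) (s.2 r)]).

Definition mstart x : C * memory := (c0, [ffun r => if r \in I then x else 0]).

(* A row is a configuration.  Its cell in column [j] carries the control state and
   the set of nonzero registers, and the sets of the registers [r] with [j < m r]
   ([here]), [j <= m r] ([before]: those of the preceding cell) and [j.+1 < m r]
   ([after]: those of the following cell). *)
Definition tile : finType :=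
  ((bool * bool) * (C * {set R}) * ({set R} * {set R} * {set R}))%type.

Implicit Types a b : tile.
Definition start_of_row a := a.1.1.1.
Definition in_first_row a := a.1.1.2.
Definition control a := a.1.2.1.
Definition nonzero a := a.1.2.2.
Definition here a := a.2.1.1.
Definition before a := a.2.1.2.
Definition after a := a.2.2.

Definition tile_ini a :=
  [&& start_of_row a, in_first_row a, control a == c0 & here a \subset I].
(** In column [x] this reads [x <= m r] and not [x < m r], hence [m r = x], for [r] in [I]. *)
Definition tile_inp a := in_first_row a && (I \subset before a :\: here a).
Definition tile_fin a := ~~ in_first_row a && (control a == halt).

(** A row may end only where no register is cut off. In the first row [here] can only shrink, so it
    encodes numbers in unary; later rows inherit this through [tile_v]. *)
Definition tile_h a a' :=
  [&& start_of_row a ==> (nonzero a == here a) && (before a == setT),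
      if start_of_row a' then (here a == set0) && (after a == set0)
      else [&& a'.1.2 == a.1.2, after a == here a' & before a' == here a] &
      in_first_row a' ==>
        [&& in_first_row a, ~~ start_of_row a' & here a' \subset here a]].

(** This is [j < m] after the action: [j < m.+1] is [j <= m], and [j < m.-1] is [j.+1 < m]. *)
Definition shifted a :=
  [set r | match act (control a) (nonzero a) r with
           | Keep => r \in here a
           | Up => r \in before a
           | Down => r \in after a
           end].

Definition tile_v a b :=
  [&& start_of_row b == start_of_row a, ~~ in_first_row b,
      control b == next (control a) (nonzero a) & here b == shifted a].

Definition cell (L : nat) (s : C * memory) (k j : nat) : tile :=
  ((j == 0, k == 0), (s.1, support s.2),
   ([set r | j < s.2 r], [set r | j <= s.2 r], [set r | j.+1 < s.2 r])).

Definition machine_tileable :=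
  tileable tile_ini tile_inp tile_fin in_first_row tile_h tile_v.

Notation run x k := (iter k mstep (mstart x)).

Lemma tileable_halts x : machine_tileable x -> exists k, (run x k).1 = halt.
Proof.
move=> [s [L [/and4P[st0 _ /eqP ct0 hereI] /andP[fx Ix] [q /andP[_ /eqP fq]]
  [fL nfL] hv]]].
have first_pred p : in_first_row (s p.+1) ->
    [&& in_first_row (s p), ~~ start_of_row (s p.+1) & here (s p.+1) \subset here (s p)].
  by have [/and3P[_ _ /implyP f] _] := hv p; exact: f.
have first_down p d : in_first_row (s (p + d)) -> in_first_row (s p).
  by elim: d => [|d IHd]; rewrite ?addn0 // addnS => /first_pred/and3P[/IHd].
(* The first row is an initial segment that contains [x] and misses [L]. *)
have xL : x < L.
  rewrite ltnNge; apply/negP=> Lx; move: fx; rewrite -(subnKC Lx).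
  by move/first_down; apply/negP.
have L0 : 0 < L by apply: leq_trans xL.
(* In the first row only position 0 starts a row, and [tile_v] copies these marks at distance
   [L]. *)
have startE k j : j < L -> start_of_row (s (k * L + j)) = (j == 0).
  move=> jL; elim: k => [|k IHk].
    by case: j jL => // j /fL/first_pred/and3P[_ /negbTE].
  by rewrite mulSn -addnA addnC; have [_ /and4P[/eqP->]] := hv (k * L + j).
have row k (st : C * memory) : control (s (k * L + 0)) = st.1 ->
    (forall j, j < L -> here (s (k * L + j)) = [set r | j < st.2 r]) ->
  forall j, j < L -> [/\ control (s (k * L + j)) = st.1,
      nonzero (s (k * L + j)) = support st.2,
      before (s (k * L + j)) = [set r | j <= st.2 r]
    & after (s (k * L + j)) = [set r | j.+1 < st.2 r]].
  move=> ctk hk j jL.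
  have -> : after (s (k * L + j)) = [set r | j.+1 < st.2 r].
    have [/and3P[_ + _] _] := hv (k * L + j); rewrite -addnS.
    (* In the last column the next cell starts a row, so [here] is empty: no register exceeds
       [j]. *)
    move: jL; rewrite leq_eqVlt => /orP[/eqP jL|jL].
      have -> : start_of_row (s (k * L + j.+1)).
        by rewrite jL addnC -mulSn -[_ * L]addn0 startE.
      rewrite hk ?jL // => /andP[/eqP/setP h0 /eqP->].
      apply/setP=> r; have := h0 r; rewrite !inE => /negbT; rewrite -ltnNge => mj.
      by apply/esym/negbTE; rewrite -leqNgt ltnW.
    by rewrite startE //= => /and3P[_ /eqP-> _]; rewrite hk.
  suff [-> -> ->] : [/\ control (s (k * L + j)) = st.1,
      nonzero (s (k * L + j)) = support st.2
    & before (s (k * L + j)) = [set r | j <= st.2 r]] by [].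
  elim: j jL => [|j IHj] jL.
    have [/and3P[/implyP + _ _] _] := hv (k * L + 0).
    rewrite startE // => /(_ isT)/andP[/eqP-> /eqP->].
    rewrite hk // ctk; split=> //; apply/setP=> r; rewrite !inE //.
    by rewrite lt0n.
  have [ctj nzj _] := IHj (ltnW jL).
  have [/and3P[_ + _] _] := hv (k * L + j); rewrite -addnS startE //=.
  move=> /and3P[/eqP e _ /eqP->].
  by rewrite /control /nonzero e hk ?(ltnW jL).
have rows k : (forall j, j < L -> control (s (k * L + j)) = (run x k).1 /\
    here (s (k * L + j)) = [set r | j < (run x k).2 r]).
  elim: k => [|k IHk] j jL.
    rewrite mul0n add0n /=; split.
      elim: j jL => // j IHj jL; have [/and3P[_ + _] _] := hv j.
      rewrite -[j.+1]add0n -(mul0n L) startE //= => /and3P[/eqP e _ _].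
      by rewrite /control e; exact/IHj/ltnW.
    have here_sub i d : i + d < L -> here (s (i + d)) \subset here (s i).
      elim: d => [|d IHd]; rewrite ?addn0 // addnS => idL.
      have /and3P[_ _ sub1] := first_pred _ (fL _ idL).
      exact: subset_trans sub1 (IHd (ltnW idL)).
    apply/setP=> r; rewrite inE ffunE; case: ifP => [rI|rI]; last first.
      apply: contraFF rI => rh.
      by apply: (subsetP hereI); apply: (subsetP (here_sub 0 j jL)).
    (* Since [here] shrinks along the row, its missing [r] in column [x] excludes all [j >= x];
       [before] there is [here] of column [x.-1], which yields all [j < x]. *)
    have := subsetP Ix _ rI; rewrite inE => /andP[nhx bx].
    case: ltnP => [jx|xj]; last first.
      apply/negbTE/negP=> rh; move/negP: nhx; apply.
      by move: rh; rewrite -(subnKC xj); apply/subsetP/here_sub; rewrite subnKC.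
    case: x jx xL bx {fx Ix nhx} => // x jx xL bx.
    have [/and3P[_ + _] _] := hv x.
    rewrite -[x.+1]add0n -(mul0n L) startE //= => /and3P[_ _ /eqP e].
    rewrite mul0n add0n in e; rewrite e in bx.
    have {}jx : j <= x by [].
    by move: bx; rewrite -(subnKC jx); apply/subsetP/here_sub; rewrite subnKC // ltnW.
  have [ct nz be af] := row k (run x k) (IHk _ L0).1 (fun i iL => (IHk i iL).2) j jL.
  have [_ he] := IHk j jL.
  have [_ /and4P[_ _ /eqP ctS /eqP heS]] := hv (k * L + j).
  rewrite mulSn -addnA addnC ctS heS ct nz; split=> //.
  apply/setP=> r; rewrite !inE ffunE ct nz he be af !inE.
  by case: (act _ _ r) => //=; rewrite ltn_predRL.
exists (q %/ L); rewrite -fq {2}(divn_eq q L).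
by have [-> _] := rows (q %/ L) (q %% L) (ltn_pmod _ L0).
Qed.

Hypothesis next_halt : forall z, next halt z = halt.
Hypothesis act_halt : forall z r, act halt z r = Keep.

Lemma mstep_halt m : mstep (halt, m) = (halt, m).
Proof.
by congr (_, _); rewrite /= ?next_halt //; apply/ffunP=> r; rewrite ffunE act_halt.
Qed.

Lemma run_halt x k d : (run x k).1 = halt -> run x (d + k) = run x k.
Proof.
rewrite iterD; case: (iter k _ _) => c m /= ->.
by elim: d => //= d ->; rewrite mstep_halt.
Qed.

Lemma halts_tileable x : (exists k, (run x k).1 = halt) -> machine_tileable x.
Proof.
(* The width exceeds the input and all registers up to time [K], after which the configuration is
   constant. *)
move=> [K hK]; pose B := \max_(k < K.+1) \max_r (run x k).2 r; pose L := (maxn x B).+1.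
have small k r : (run x k).2 r < L.
  rewrite ltnS leq_max; apply/orP; right.
  wlog: k / k <= K => [small|kK].
    by case: (leqP k K) => [/small//|/ltnW Kk]; rewrite -(subnK Kk) run_halt // small.
  have := leq_bigmax (Ordinal (kK : k < K.+1)) (F := fun k : 'I_K.+1 => \max_r (run x k).2 r).
  by apply: leq_trans; apply: (leq_bigmax r).
have xL : x < L by rewrite ltnS leq_maxl.
pose s p := cell L (run x (p %/ L)) (p %/ L) (p %% L).
exists s, L; split.
- rewrite /s div0n mod0n; apply/and4P; split=> //=.
  by apply/subsetP=> r; rewrite inE ffunE; case: ifP.
- rewrite /s divn_small // modn_small //; apply/andP; split=> //=.
  by apply/subsetP=> r rI; rewrite !inE ffunE rI ltnn leqnn.
(* Row [K.+1] instead of [K]: a final tile must lie outside the first row, and [K] may be 0. *)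
- exists (K.+1 * L); rewrite /s mulnK // modnMl; apply/andP; split=> //=.
  by rewrite -[control _]/(run x (1 + K)).1 run_halt ?hK.
- split=> [p pL|]; first by rewrite /s divn_small.
  by rewrite /s divnn.
move=> p; split; last first.
  rewrite /s divnDr // divnn /= modnDr addn1; apply/and4P; split=> //=.
  apply/eqP/setP=> r; rewrite !inE ffunE /=.
  by case: (act _ _ r); rewrite //= ltn_predRL.
have start_ok : start_of_row (s p) ==> (nonzero (s p) == here (s p)) && (before (s p) == setT).
  apply/implyP=> /eqP p0; rewrite /s p0; apply/andP.
  by split; apply/eqP/setP=> r; rewrite !inE // lt0n.
have [wrap|nowrap] := eqVneq (p %% L).+1 L.
  have pS : p.+1 = (p %/ L).+1 * L by rewrite mulSn addnC {1}(divn_eq p L) -addnS wrap.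
  apply/and3P; split=> //; rewrite /s pS mulnK // modnMl //=.
  have le_m r : (run x (p %/ L)).2 r <= p %% L by rewrite -ltnS wrap small.
  by apply/andP; split; apply/eqP/setP=> r; rewrite !inE ltnNge ?le_m // leqW.
have jL : (p %% L).+1 < L by rewrite ltn_neqAle nowrap ltn_pmod.
have pS : p.+1 = (p %/ L) * L + (p %% L).+1 by rewrite addnS -divn_eq.
apply/and3P; split=> //; rewrite /s pS divnMDl // (divn_small jL) addn0 modnMDl
    (modn_small jL).
  by rewrite /= !eqxx.
apply/implyP=> first_p; apply/and3P; split=> //; apply/subsetP=> r; rewrite !inE.
exact: ltnW.
Qed.

End Machine.

(** * The diagonal machine *)

(* [CodeSeq.code (n :: w)] is [2 ^ n * (2 * CodeSeq.code w + 1)], so putting a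
   word in front of a coded one is a sequence of maps [y |-> 2 * y + b]. *)
Fixpoint code_ops (w : seq nat) : seq bool :=
  if w is n :: w' then code_ops w' ++ true :: nseq n false else [::].

Definition push (y : nat) (b : bool) := y.*2 + b.

Lemma code_ops_cat w v :
  foldl push (CodeSeq.code v) (code_ops w) = CodeSeq.code (w ++ v).
Proof.
elim: w => //= n w IHw; rewrite foldl_cat IHw /= /push addn1 mulnC.
elim: n (_.+1) => [|n IHn] y /=; first by rewrite expn0 muln1.
by rewrite IHn addn0 -muln2 -mulnA -expnS.
Qed.

(* What precedes the block of [Next]s in the coded instance. *)
Definition prefix_word := [:: 0; 0; 0; 1; 3; 1; 2; 1; 2].
(** A letter [n] costs [n.+1] operations, so nine letters of sum 10 take 19. The length bound keeps
    the control states finite. *)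
Definition prefix_ops : 19.-bseq bool :=
  Bseq (isT : size (code_ops prefix_word) <= 19).
(* [4] is the letter that codes [Next]. *)
Definition next_ops : 19.-bseq bool := Bseq (isT : size (code_ops [:: 4]) <= 19).

Lemma size_behead_ops (s : 19.-bseq bool) : size (behead s) <= 19.
Proof. by rewrite size_behead (leq_trans (leq_pred _)) ?size_bseq. Qed.

Definition behead_ops s := Bseq (size_behead_ops s).

Lemma code_next_ops x v :
  iter x (fun y => foldl push y next_ops) (CodeSeq.code v) =
  CodeSeq.code (nseq x 4 ++ v).
Proof. by elim: x => // x IHx; rewrite iterS IHx (code_ops_cat [:: 4]). Qed.

Section Diagonal.
Variable P : program.

Definition register_of (i : instr) := match i with Inc r _ | Dec r _ _ => r end.

(** The sum bounds every register of [P]; the added 3 makes room for registers 0 to 3. *)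
Definition last_register := (\sum_(i <- P) register_of i).+3.
Definition register : finType := 'I_last_register.+1.
Definition reg (k : nat) : register := inord k.

(* In state [inl (loop, back, s)] the operations in [s] remain to be applied to
   register 0.  One operation drains register 0 into registers 2 and 3 ([back]
   false), then pours both back into it ([back] true).  While [loop] holds, an
   exhausted [s] is replaced by [next_ops] as often as register 1 tells, and then
   by [prefix_ops].  State [inr (Some pc)] runs [P]; a halted [P] with output 0
   leads to [inr None], a nonzero output to an endless loop. *)
Definition control_state : finType :=
  (bool * bool * 19.-bseq bool + option 'I_(size P).+1)%type.
(** All addresses outside the program are merged into [size P], to have finitely many states. *)
Definition at_pc l : control_state := inr (Some (inord (minn l (size P)))).
Definition stop : control_state := inr None.

Definition diag_next (c : control_state) (z : {set register}) : control_state :=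
  match c with
  | inl (loop, back, s) =>
    match val s with
    | [::] =>
      if ~~ loop then at_pc 0
      else if reg 1 \in z then inl (true, false, next_ops)
      else inl (false, false, prefix_ops)
    | _ :: _ =>
      if back then
        if (reg 2 \in z) || (reg 3 \in z) then c
        else inl (loop, false, behead_ops s)
      else if reg 0 \in z then c else inl (loop, true, s)
    end
  | inr (Some pc) =>
    match onth P pc with
    | Some (Inc _ l) => at_pc l
    | Some (Dec r l l0) => at_pc (if reg r \in z then l else l0)
    | None => if reg 0 \in z then c else stop
    end
  | inr None => c
  end.

Definition diag_act (c : control_state) (z : {set register}) (r : register) :=
  match c with
  | inl (loop, back, s) =>
    match val s with
    | [::] => if loop && (val r == 1) then Down else Keep
    | b :: _ =>
      if back then
        if reg 2 \in z then
          if val r == 2 then Down else if val r == 0 then Up else Keep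
        else if reg 3 \in z then
          if val r == 3 then Down else if val r == 0 then Up else Keep
        else Keep
      else if reg 0 \in z then
        if val r == 0 then Down
        else if (val r == 2) || (val r == 3) then Up else Keep
      else if b && (val r == 2) then Up else Keep
    end
  | inr (Some pc) =>
    match onth P pc with
    | Some (Inc r' _) => if val r == r' then Up else Keep
    | Some (Dec r' _ _) => if val r == r' then Down else Keep
    | None => Keep
    end
  | inr None => Keep
  end.

Definition diag_ini : control_state := inl (true, false, [bseq]).
(** The input serves twice: register 0 holds it as a code, register 1 as the number of letters 4 to
    be added. *)
Definition diag_input := [set reg 0; reg 1].

(** * Runs of the diagonal machine up to the start of [P] *)

Notation mem4 y x a b := ([ffun r : register => nth 0 [:: y; x; a; b] r] : memory register).
Notation diag_step := (mstep diag_next diag_act).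
Notation run x k := (iter k diag_step (mstart diag_ini diag_input x)).

Definition reaches s s' := exists k, iter k diag_step s = s'.

Lemma reaches_refl s : reaches s s.
Proof. by exists 0. Qed.

Lemma reaches_trans s2 s1 s3 : reaches s1 s2 -> reaches s2 s3 -> reaches s1 s3.
Proof. by move=> [k <-] [l <-]; exists (l + k); rewrite iterD. Qed.

Lemma reaches_step s s' : reaches (diag_step s) s' -> reaches s s'.
Proof. by apply: reaches_trans; exists 1. Qed.

Lemma regE k : k < 4 -> reg k = k :> nat.
Proof. by move=> k4; rewrite inordK // (leq_trans k4). Qed.

Lemma reg_support k y x a b : k < 4 ->
  (reg k \in support (mem4 y x a b)) = (nth 0 [:: y; x; a; b] k != 0).
Proof. by move=> k4; rewrite inE ffunE regE. Qed.

Lemma eq_mem4 (m : memory register) y x a b :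
  (forall r, m r = nth 0 [:: y; x; a; b] r) -> m = mem4 y x a b.
Proof. by move=> e; apply/ffunP=> r; rewrite e ffunE. Qed.

Lemma start_mem4 x : mstart diag_ini diag_input x = (diag_ini, mem4 x x 0 0).
Proof.
congr (_, _); apply: eq_mem4 => r; rewrite ffunE !inE -!val_eqE /= !regE //.
by case: r => [[|[|[|[|r]]]] ?] //=; rewrite nth_nil.
Qed.

Lemma step_drain l (s : 19.-bseq bool) b s' y x a a' : val s = b :: s' ->
  diag_step (inl (l, false, s), mem4 y.+1 x a a') =
    (inl (l, false, s), mem4 y x a.+1 a'.+1).
Proof.
move=> e; rewrite /mstep /= e reg_support //=; congr (_, _); apply: eq_mem4.
by case=> [[|[|[|[|r]]]] ?]; rewrite !ffunE /= ?nth_nil.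
Qed.

Lemma step_drained l (s : 19.-bseq bool) b s' x a a' : val s = b :: s' ->
  diag_step (inl (l, false, s), mem4 0 x a a') =
    (inl (l, true, s), mem4 0 x (a + b) a').
Proof.
move=> e; rewrite /mstep /= e reg_support //=; congr (_, _); apply: eq_mem4.
by case=> [[|[|[|[|r]]]] ?]; rewrite !ffunE /= ?nth_nil ?andbF //;
  case: b {e}; rewrite /= ?addn0 ?addn1.
Qed.

Lemma step_refill2 l (s : 19.-bseq bool) b s' y x a a' : val s = b :: s' ->
  diag_step (inl (l, true, s), mem4 y x a.+1 a') =
    (inl (l, true, s), mem4 y.+1 x a a').
Proof.
move=> e; rewrite /mstep /= e !reg_support //=; congr (_, _); apply: eq_mem4.
by case=> [[|[|[|[|r]]]] ?]; rewrite !ffunE /= ?nth_nil.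
Qed.

Lemma step_refill3 l (s : 19.-bseq bool) b s' y x a' : val s = b :: s' ->
  diag_step (inl (l, true, s), mem4 y x 0 a'.+1) =
    (inl (l, true, s), mem4 y.+1 x 0 a').
Proof.
move=> e; rewrite /mstep /= e !reg_support //=; congr (_, _); apply: eq_mem4.
by case=> [[|[|[|[|r]]]] ?]; rewrite !ffunE /= ?nth_nil.
Qed.

Lemma step_refilled l (s : 19.-bseq bool) b s' y x : val s = b :: s' ->
  diag_step (inl (l, true, s), mem4 y x 0 0) =
    (inl (l, false, behead_ops s), mem4 y x 0 0).
Proof.
move=> e; rewrite /mstep /= e !reg_support //=; congr (_, _); apply: eq_mem4.
by case=> [[|[|[|[|r]]]] ?]; rewrite !ffunE /= ?nth_nil.
Qed.

Lemma reaches_drain l (s : 19.-bseq bool) b s' y x a a' : val s = b :: s' ->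
  reaches (inl (l, false, s), mem4 y x a a')
          (inl (l, true, s), mem4 0 x (a + y + b) (a' + y)).
Proof.
move=> e; elim: y a a' => [|y IHy] a a'; apply: reaches_step.
  by rewrite (step_drained _ _ _ _ e) !addn0; apply: reaches_refl.
by rewrite (step_drain _ _ _ _ _ e) !addnS -!addSn.
Qed.

Lemma reaches_refill l (s : 19.-bseq bool) b s' y x a a' : val s = b :: s' ->
  reaches (inl (l, true, s), mem4 y x a a')
          (inl (l, false, behead_ops s), mem4 (y + a + a') x 0 0).
Proof.
move=> e; elim: a y => [|a IHa] y; last first.
  by apply: reaches_step; rewrite (step_refill2 _ _ _ _ _ e) addnS -addSn.
elim: a' y => [|a' IHa'] y; apply: reaches_step; rewrite addn0.
  by rewrite (step_refilled _ _ _ e) addn0; apply: reaches_refl.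
by have := IHa' y.+1; rewrite (step_refill3 _ _ _ _ e) addn0 addnS -addSn.
Qed.

(** Draining [y] leaves [y + b] in register 2 and [y] in register 3; pouring both back gives
    [y.*2 + b]. *)
Lemma reaches_ops l (s : 19.-bseq bool) y x :
  reaches (inl (l, false, s), mem4 y x 0 0)
          (inl (l, false, [bseq]), mem4 (foldl push y s) x 0 0).
Proof.
case: s => s; elim: s y => [|b s IHs] y s19.
  have -> : Bseq s19 = [bseq] by apply/val_inj.
  exact: reaches_refl.
apply: reaches_trans (reaches_drain l y x 0 0 (erefl : val (Bseq s19) = b :: s)) _.
apply: reaches_trans (reaches_refill l _ x _ _ (erefl : val (Bseq s19) = b :: s)) _.
have -> : behead_ops (Bseq s19) = Bseq (ltnW s19) by apply/val_inj.
rewrite !add0n -[y + b + y]addnA [b + y]addnC addnA addnn.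
exact: IHs.
Qed.

Lemma reaches_loop y x :
  reaches (diag_ini, mem4 y x 0 0)
    (inl (false, false, prefix_ops),
     mem4 (iter x (fun y => foldl push y next_ops) y) 0 0 0).
Proof.
have stepE z : diag_step (diag_ini, mem4 y z 0 0) =
    (if z != 0 then inl (true, false, next_ops) else inl (false, false, prefix_ops),
     mem4 y z.-1 0 0).
  rewrite /mstep /= reg_support //=; congr (_, _); apply: eq_mem4.
  by case=> [[|[|[|[|r]]]] ?]; rewrite !ffunE /= ?nth_nil.
elim: x y stepE => [|x IHx] y stepE; apply: reaches_step; rewrite stepE.
  exact: reaches_refl.
rewrite iterSr; apply: reaches_trans (reaches_ops _ _ _ _) _.
apply: IHx => z; rewrite /mstep /= reg_support //=; congr (_, _); apply: eq_mem4.
by case=> [[|[|[|[|r]]]] ?]; rewrite !ffunE /= ?nth_nil.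
Qed.

Lemma reaches_program x v : x = CodeSeq.code v ->
  reaches (mstart diag_ini diag_input x)
    (at_pc 0, mem4 (CodeSeq.code (prefix_word ++ nseq x 4 ++ v)) 0 0 0).
Proof.
move=> xE; rewrite start_mem4; apply: reaches_trans (reaches_loop _ _) _.
(* Only the contents of register 0 become a code; the [x] that counts iterations stays. *)
rewrite {2}xE code_next_ops -(code_ops_cat prefix_word).
have stepE m : diag_step (inl (false, false, [bseq]), m) = (at_pc 0, m).
  by congr (_, _); apply/ffunP=> r; rewrite ffunE.
apply: reaches_trans (reaches_ops _ _ _ _) _; apply: reaches_step.
by rewrite stepE; apply: reaches_refl.
Qed.

(** * Simulation of [P] and reaction to its output *)

Lemma register_bound pc i : onth P pc = Some i -> register_of i <= last_register.
Proof.
move=> iP; do 3!apply: leqW.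
elim: P pc iP => [|j Q IHQ] [|pc] //=; rewrite big_cons.
  by move=> [->]; exact: leq_addr.
by move=> /IHQ /leq_trans; apply; exact: leq_addl.
Qed.

Definition simulates (s : control_state * memory register) (c : config) :=
  s.1 = at_pc c.1 /\ forall r, s.2 r = c.2 (val r).

Lemma simulates_step s c : simulates s c ->
  exists2 s', reaches s s' & simulates s' (step P c).
Proof.
case: s c => [q m] [pc m'] [/= -> mE]; case iP: (onth P pc) => [i|]; last first.
  (* A halted [P] is simulated by zero steps, since a real step might already lead to [stop]. *)
  by exists (at_pc pc, m); [apply: reaches_refl | split].
have pcP : pc < size P by rewrite -onthTE iP.
have pcE : onth P (@inord (size P) (minn pc (size P))) = Some i.
  by rewrite (minn_idPl (ltnW pcP)) inordK // ltnS ltnW.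
exists (diag_step (at_pc pc, m)); first by exists 1.
have iR := register_bound iP.
have zE : (inord (register_of i) \in support m) = (m' (register_of i) != 0).
  by rewrite inE mE /= inordK.
case: i iP pcE iR zE => [r l|r l l0] iP pcE iR zE; split=> [|r']; rewrite /mstep /= pcE //.
- by rewrite ffunE /update mE; case: eqP => // ->.
- by rewrite zE; case: (m' r).
(* [Down] is applied to a zero register too, harmlessly, as [0.-1] is 0. *)
rewrite ffunE /update mE /=.
by have [e|_] := eqVneq (m' r) 0; case: eqVneq => [->|/negbTE nr];
  rewrite /= ?e ?eqxx ?nr.
Qed.

Lemma simulates_iter s c k : simulates s c ->
  exists2 s', reaches s s' & simulates s' (iter k (step P) c).
Proof.
move=> sc; elim: k => [|k [s1 ss1 s1c]]; first by exists s; [apply: reaches_refl|].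
have [s2 s12 s2c] := simulates_step s1c.
by exists s2 => //; apply: reaches_trans s12.
Qed.

Lemma reaches_output x v y : x = CodeSeq.code v ->
    outputs P (CodeSeq.code (prefix_word ++ nseq x 4 ++ v)) y ->
  exists m : memory register, m (reg 0) = y /\
    reaches (mstart diag_ini diag_input x) (at_pc (size P), m).
Proof.
move=> xE [k]; set n := CodeSeq.code _.
case e: (iter k _ _) => [pc m'] [pcP m0].
have sim0 : simulates (at_pc 0, mem4 n 0 0 0) (Defs.start n).
  split=> // -[[|[|[|[|r]]]] ?]; rewrite ffunE //=.
  by rewrite nth_nil.
have [[q m] reach_m] := simulates_iter k sim0; rewrite e => -[/= qE mE].
exists m; split; first by rewrite mE regE.
have -> : at_pc (size P) = q by rewrite qE /at_pc (minn_idPr pcP) minnn.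
exact: reaches_trans (reaches_program xE) reach_m.
Qed.

Lemma step_output m : diag_step (at_pc (size P), m) =
  (if m (reg 0) == 0 then stop else at_pc (size P), m).
Proof.
have e : onth P (@inord (size P) (minn (size P) (size P))) = None.
  by rewrite minnn inordK // onth_default.
rewrite /mstep /= e inE; case: (m (reg 0) == 0); congr (_, _);
  by apply/ffunP=> r; rewrite ffunE.
Qed.

Definition halts x := exists k, (run x k).1 = stop.

Lemma stop_next z : diag_next stop z = stop.
Proof. by []. Qed.

Lemma stop_act z r : diag_act stop z r = Keep.
Proof. by []. Qed.

Lemma halts_output0 x v : x = CodeSeq.code v ->
  outputs P (CodeSeq.code (prefix_word ++ nseq x 4 ++ v)) 0 -> halts x.
Proof.
move=> xE /(reaches_output xE)[m [m0 [k runk]]]; exists k.+1.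
by rewrite iterS runk step_output m0.
Qed.

(** A nonzero output makes the configuration a fixed point different from [stop]; a halting run
    would be in both at time [k + l]. *)
Lemma loops_output1 x v : x = CodeSeq.code v ->
  outputs P (CodeSeq.code (prefix_word ++ nseq x 4 ++ v)) 1 -> ~ halts x.
Proof.
move=> xE /(reaches_output xE)[m [m1 [k runk]]] [l runl].
have fixed j : iter j diag_step (at_pc (size P), m) = (at_pc (size P), m).
  by elim: j => // j IHj; rewrite iterS IHj step_output m1.
have := run_halt stop_next stop_act k runl.
by rewrite addnC iterD runk fixed => e; rewrite -e in runl.
Qed.

End Diagonal.

(** * The diagonal argument *)

Theorem theorem5 :
  ~ exists P : program,
      decides P encode (fun i : instance => models (structure i) (spec i)).
Proof.
move=> [P decP].
pose ini := tile_ini (diag_ini P) (diag_input P).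
pose inp := tile_inp (C := control_state P) (diag_input P).
pose fin := tile_fin (R := register P) (stop P).
pose first := @in_first_row (control_state P) (register P).
pose h := @tile_h (control_state P) (register P).
pose v := tile_v (@diag_next P) (@diag_act P).
have [w wordE] := tiling_formula_word ini inp fin first h v.
pose tail := w ++ kripke_word (tiling_kripke (tile (control_state P) (register P))).
(* There is no circularity: [w] and the Kripke structure are fixed before [x] is chosen. *)
pose x := CodeSeq.code tail.
pose i := Instance (tiling_kripke _) (tiling_formula_closed ini inp fin first h v x).
have encE : encode i = CodeSeq.code (prefix_word ++ nseq x 4 ++ tail).
  by rewrite /encode wordE -!catA.
have modelsE : models (structure i) (spec i) <-> halts P x.
  rewrite models_tiling; last by move=> a /andP[].
  split; first exact: tileable_halts.
  exact: (halts_tileable (@stop_next P) (@stop_act P)).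
have [out1 out0] := decP i; rewrite encE in out1 out0.
(* If the machine halts on [x], then [P] answers 1 and it loops; hence it does not halt, so [P]
   answers 0 and it halts. *)
have not_halts hx : False := loops_output1 (erefl x) (out1 (modelsE.2 hx)) hx.
by apply: (not_halts); apply: (halts_output0 (erefl x)); apply: out0 => /modelsE/not_halts.
Qed.
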